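(* Let $K$ be a field, let $n\geq 1$, let $A_1,\ldots,A_n$ be non-empty finite subsets of $K$, let $d_i=|A_i|$, and let $Y=\{[(\gamma_1,\ldots,\gamma_n,1)] : \gamma_i\in A_i\text{ for all }i\}\subset\mathbb{P}^n$ (projective space over $K$). Let $I(Y)\subset S[u]=K[t_1,\ldots,t_n,u]$ be the vanishing ideal of $Y$. Then: (a) $I(Y)=\left(\prod_{\gamma\in A_1}(t_1-u\gamma),\ldots,\prod_{\gamma\in A_n}(t_n-u\gamma)\right)$. (b) $I(Y)$ is a complete intersection. (c) $F_Y(t)=\dfrac{\prod_{i=1}^n(1+t+\cdots+t^{d_i-1})}{1-t}$. (d) $\mathrm{reg}\, S[u]/I(Y)=\sum_{i=1}^n(d_i-1)$ and $\deg(S[u]/I(Y))=|Y|=d_1\cdots d_n$.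
   Context: $S[u]=\bigoplus_{d\geq 0}S[u]_d$ is the polynomial ring $K[t_1,\ldots,t_n,u]$ with the standard grading ($u$ being the last variable). The vanishing ideal $I(Y)$ is the ideal generated by the homogeneous polynomials of $S[u]$ that vanish on $Y$. A homogeneous ideal $I$ is a complete intersection if there are homogeneous polynomials $g_1,\ldots,g_r$ with $I=(g_1,\ldots,g_r)$, where $r$ is the height of $I$. The Hilbert function is $H_Y(d)=\dim_K(S[u]_d/(I(Y)\cap S[u]_d))$ and the Hilbert series is $F_Y(t)=\sum_{i\geq 0}H_Y(i)t^i$. The degree of $S[u]/I(Y)$ is the constant value of $H_Y(d)$ for all large $d$ (which equals $|Y|$), and the regularity $\mathrm{reg}\, S[u]/I(Y)$ is the least integer $\ell\geq 0$ such that $H_Y(d)=|Y|$ for all $d\geq\ell$. *)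

(* Defs.v *)
From HB Require Import structures.
From mathcomp Require Import all_boot all_order all_algebra.
From mathcomp Require Import finmap.
From mathcomp Require Import boolp classical_sets.
From mathcomp Require Import mpoly.

Set Implicit Arguments.
Unset Strict Implicit.
Unset Printing Implicit Defensive.

Import GRing.Theory.

Local Open Scope ring_scope.
Local Open Scope classical_set_scope.

Section Ideals.
Variable R : comNzRingType.
Implicit Types (I P : set R).

Definition is_ideal I :=
  [/\ I 0, forall a b, I a -> I b -> I (a + b) & forall c a, I a -> I (c * a)].

Definition ideal_gen (G : set R) : set R := smallest is_ideal G.

Definition is_prime_ideal P :=
  [/\ is_ideal P, ~ P 1 & forall a b, P (a * b) -> P a \/ P b].

(* A chain C 0 < C 1 < ... < C h = P; the values C k for k > h are irrelevant. *)
Definition has_prime_chain P (h : nat) :=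
  exists C : nat -> set R,
    [/\ forall k, (k <= h)%N -> is_prime_ideal (C k),
        forall k, (k < h)%N -> C k `<` C k.+1 & C h = P].

Definition prime_height_is P (h : nat) :=
  has_prime_chain P h /\ forall k, has_prime_chain P k -> (k <= h)%N.

(* The height of I is the least height of a prime containing I. *)
Definition height_is I (h : nat) :=
  (exists P, [/\ is_prime_ideal P, I `<=` P & prime_height_is P h]) /\
  (forall P k, is_prime_ideal P -> I `<=` P -> prime_height_is P k -> (h <= k)%N).

Lemma ideal_gen_ideal (G : set R) : is_ideal (ideal_gen G).
Proof.
split; first by move=> J [[]].
- by move=> a b Ga Gb J GJ; case: (GJ) => -[_ + _] _; apply; [exact: Ga|exact: Gb].
- by move=> c a Ga J GJ; case: (GJ) => -[_ _ +] _; apply; exact: Ga.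
Qed.

End Ideals.

Section Codimension.
Variables (K : fieldType) (V : vectType K).
Implicit Types (W : set V) (U : {vspace V}).

(* dim_K (V / W) = h: the classes of some b_1, ..., b_h form a basis of V / W. *)
Definition codim_is W (h : nat) :=
  exists b : h.-tuple V, forall v : V,
    exists! c : 'rV[K]_h, W (v - \sum_i c 0 i *: tnth b i).

Definition codim W : nat := xget 0%N (codim_is W).

Lemma codim_is_vspace U : codim_is [set` U] (\dim U^C).
Proof.
pose b := vbasis U^C; exists b => v.
have /memv_addP[u uU [w wU e]] : v \in (U + U^C)%VS by rewrite addv_complf memvf.
pose c : 'rV[K]_(\dim U^C) := \row_i coord b i w.
have wE : \sum_i c 0 i *: tnth b i = w.
  rewrite (coord_vbasis wU); apply: eq_bigr => i _.
  by rewrite mxE -tnth_nth.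
exists c; split => [/=|c' /= c'U]; first by rewrite wE e addrK.
have bU (a : 'rV[K]_(\dim U^C)) : \sum_i a 0 i *: tnth b i \in (U^C)%VS.
  by apply: rpred_sum => i _; apply/rpredZ/vbasis_mem/mem_tnth.
have w0 : \sum_i (c 0 i - c' 0 i) *: tnth b i = 0.
  under eq_bigr do rewrite scalerBl.
  apply/eqP; rewrite sumrB -memv0 -(capv_compl U) memv_cap.
  apply/andP; split; last exact: rpredB.
  rewrite wE; have -> : w = v - u by rewrite e addrAC subrr add0r.
  by rewrite addrAC rpredB.
have /freeP fb := basis_free (vbasisP U^C).
apply/rowP => i; apply/eqP; rewrite -subr_eq0; apply/eqP.
apply: (fb (fun i => c 0 i - c' 0 i)); rewrite -[RHS]w0.
by apply: eq_bigr => j _; rewrite -tnth_nth.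
Qed.

Lemma codim_is_uniq U h : codim_is [set` U] h -> h = \dim U^C.
Proof.
case=> b bP.
have zmod : forall c : 'rV[K]_h, \sum_i c 0 i *: tnth b i \in U -> c = 0.
  move=> c cU; have [c0 [_ u0]] := bP 0.
  rewrite -(u0 c); last by rewrite /= sub0r rpredN.
  by apply: u0; rewrite /= big1 ?subr0 ?mem0v // => i _; rewrite mxE scale0r.
have sumE (k : 'I_h -> K) :
    \sum_i (\row_j k j : 'rV[K]_h) 0 i *: tnth b i = \sum_(i < h) k i *: b`_i.
  by apply: eq_bigr => i _; rewrite mxE (tnth_nth 0).
have fb : free b.
  apply/freeP => k k0 i; have := zmod (\row_j k j).
  by rewrite sumE k0 mem0v => /(_ isT)/rowP/(_ i); rewrite !mxE.
have cap0 : (U :&: <<b>> = 0)%VS.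
  apply/eqP; rewrite -subv0; apply/subvP => x /memv_capP[xU xb].
  have := zmod (\row_j coord b j x); rewrite sumE -coord_span // => /(_ xU) e.
  rewrite memv0 (coord_span xb) big1 // => i _.
  by have /rowP/(_ i) := e; rewrite !mxE => ->; rewrite scale0r.
have full : (U + <<b>> = fullv)%VS.
  apply/eqP; rewrite eqEsubv subvf; apply/subvP => v _.
  have [c [/= cU _]] := bP v; rewrite -(subrK (\sum_i c 0 i *: tnth b i) v).
  apply: memv_add => //; apply: rpred_sum => i _.
  by apply/rpredZ/memv_span/mem_tnth.
have := dimv_disjoint_sum cap0; rewrite full.
move: (fb); rewrite /free size_tuple => /eqP ->.
have := dimv_disjoint_sum (capv_compl U); rewrite addv_complf => -> /addnI.
by [].
Qed.

Lemma sub_vspace W :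
    W 0 -> (forall a b, W a -> W b -> W (a + b)) ->
    (forall c a, W a -> W (c *: a)) ->
  exists U, W = [set` U].
Proof.
move=> W0 WD WZ.
pose Q k := `[< exists2 U : {vspace V}, [set` U] `<=` W & \dim U = k >].
have Qex : exists k, Q k.
  exists 0%N; apply/asboolP; exists 0%VS; last exact: dimv0.
  by move=> x /=; rewrite memv0 => /eqP ->.
have Qub k : Q k -> (k <= \dim {:V})%N.
  by move=> /asboolP[U _ <-]; exact/dimvS/subvf.
case: (ex_maxnP Qex Qub) => m /asboolP[U UW <-] mmax.
exists U; apply/seteqP; split => // x Wx /=.
have le : (\dim (U + <[x]>) <= \dim U)%N.
  apply: mmax; apply/asboolP; exists (U + <[x]>)%VS => // y /= /memv_addP[u uU].
  by move=> [z /vlineP[k ->] ->]; apply: WD; [exact: UW|exact: WZ].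
have e : U = (U + <[x]>)%VS by apply/eqP; rewrite eqEdim addvSl.
by rewrite e; apply: (subvP (addvSr _ _)); exact: memv_line.
Qed.

Lemma codimP W h :
    W 0 -> (forall a b, W a -> W b -> W (a + b)) ->
    (forall c a, W a -> W (c *: a)) ->
  codim_is W h <-> codim W = h.
Proof.
move=> W0 WD WZ; have [U WU] := sub_vspace W0 WD WZ.
have cW : codim_is W (codim W).
  by apply: (xgetPex 0%N); exists (\dim U^C); rewrite WU; exact: codim_is_vspace.
split => [|<- //]; move: cW; rewrite WU => /codim_is_uniq -> /codim_is_uniq ->.
by [].
Qed.

End Codimension.

Section ProjectiveSpace.
Variables (K : fieldType) (n : nat).
Local Notation S := {mpoly K[n.+1]}.

(* The points of P^n are the lines through the origin of K^(n+1). *)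
Definition proj_space := {L : {vspace 'rV[K]_n.+1} | \dim L == 1%N}.

Lemma proj_point_subproof (v : 'rV[K]_n.+1) : v != 0 -> \dim <[v]>%VS == 1%N.
Proof. by move=> v0; rewrite dim_vline v0. Qed.

Definition proj_point (v : 'rV[K]_n.+1) (v0 : v != 0) : proj_space :=
  exist _ <[v]>%VS (proj_point_subproof v0).

Definition homogeneous (f : S) := exists d : nat, f \is d.-homog.

Definition vanishes_at (f : S) (P : proj_space) :=
  forall v : 'rV[K]_n.+1, v \in val P -> v != 0 -> f.@[fun i => v 0 i] = 0.

Definition vanishing_ideal (Y : {fset proj_space}) : set S :=
  ideal_gen [set f | homogeneous f /\ forall P, P \in Y -> vanishes_at f P].

Definition complete_intersection (I : set S) :=
  exists (r : nat) (g : 'I_r -> S),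
    [/\ forall i, homogeneous (g i), I = ideal_gen (range g) & height_is I r].

(* [dhomog n.+1 K d] is the space of forms of degree d, including 0. *)
Definition hilbert_function (Y : {fset proj_space}) (d : nat) : nat :=
  codim [set p : dhomog n.+1 K d | vanishing_ideal Y (mpoly_of_dhomog p)].

Lemma hilbert_functionP (Y : {fset proj_space}) (d h : nat) :
  codim_is [set p : dhomog n.+1 K d | vanishing_ideal Y (mpoly_of_dhomog p)] h
  <-> hilbert_function Y d = h.
Proof.
have [I0 ID IM] := ideal_gen_ideal
  [set f : S | homogeneous f /\ forall P, P \in Y -> vanishes_at f P].
apply: codimP => [|a b Ia Ib|c a Ia].
- exact: I0.
- exact: ID.
- by rewrite /= -mul_mpolyC; exact: IM.
Qed.

Definition degree_is (Y : {fset proj_space}) (D : nat) :=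
  exists d0 : nat, forall d, (d0 <= d)%N -> hilbert_function Y d = D.

Definition regularity_is (Y : {fset proj_space}) (l : nat) :=
  (forall d, (l <= d)%N -> hilbert_function Y d = #|` Y|) /\
  (forall l', (forall d, (l' <= d)%N -> hilbert_function Y d = #|` Y|) ->
     (l <= l')%N).

End ProjectiveSpace.

Section Grid.
Variables (K : fieldType) (n : nat).
Local Notation S := {mpoly K[n.+1]}.

(* The last of the n.+1 variables is u; [lift ord_max i] has the value of i. *)
Definition t_ (i : 'I_n) : S := 'X_(lift ord_max i).
Definition u_ : S := 'X_ord_max.

(* The vector (a_1, ..., a_n, 1). *)
Definition affine_vec (a : 'I_n -> K) : 'rV[K]_n.+1 :=
  \row_j (if unlift ord_max j is Some i then a i else 1).

Lemma affine_vec_neq0 (a : 'I_n -> K) : affine_vec a != 0.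
Proof.
apply/eqP => /rowP/(_ ord_max); rewrite !mxE unlift_none => /eqP.
by rewrite oner_eq0.
Qed.

Definition affine_point (a : 'I_n -> K) : proj_space K n :=
  proj_point (affine_vec_neq0 a).

Definition projective_grid (A : 'I_n -> {fset K}) : {fset proj_space K n} :=
  [fset P in [seq affine_point (fun i => val (a i))
                | a : {dffun forall i : 'I_n, A i}]]%fset.

Lemma projective_gridP (A : 'I_n -> {fset K}) (P : proj_space K n) :
  P \in projective_grid A <->
  exists2 a : 'I_n -> K, (forall i, a i \in A i) & P = affine_point a.
Proof.
rewrite inE; split=> [/mapP[a _ ->]|[a aA ->]].
  by exists (fun i => val (a i)) => // i; exact: valP.
pose b : {dffun forall i : 'I_n, A i} := finfun (fun i => [` aA i]%fset).
apply/mapP; exists b; first by rewrite mem_enum.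
by congr affine_point; apply/funext => i; rewrite ffunE.
Qed.

End Grid.

Section PowerSeries.
Variable R : comUnitRingType.
Implicit Types f g : nat -> R.

(* The formal power series \sum_k (f k) t^k is represented by f : nat -> R. *)
Definition fps_mul f g : nat -> R := fun k => \sum_(i < k.+1) f i * g (k - i)%N.

Definition fps_of_poly (p : {poly R}) : nat -> R := fun k => p`_k.

Fixpoint fps_inv_seq f (k : nat) : seq R :=
  if k is k'.+1 then
    let s := fps_inv_seq f k' in
    rcons s (- (f 0%N)^-1 * \sum_(i < k'.+1) f (k'.+1 - i)%N * s`_i)
  else [:: (f 0%N)^-1].

(* The inverse of f, for f 0 a unit: see [fps_mulVf]. *)
Definition fps_inv f : nat -> R := fun k => (fps_inv_seq f k)`_k.

Definition fps_div f g : nat -> R := fps_mul f (fps_inv g).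

Lemma size_fps_inv_seq f k : size (fps_inv_seq f k) = k.+1.
Proof. by elim: k => //= k IHk; rewrite size_rcons IHk. Qed.

Lemma nth_fps_inv_seq f k i : (i <= k)%N -> (fps_inv_seq f k)`_i = fps_inv f i.
Proof.
elim: k => [|k IHk]; first by rewrite leqn0 => /eqP ->.
rewrite leq_eqVlt => /predU1P[-> //|ik] /=.
by rewrite nth_rcons size_fps_inv_seq ik IHk.
Qed.

Lemma fps_mulVf f :
  f 0%N \is a GRing.unit -> fps_mul (fps_inv f) f = fps_of_poly 1.
Proof.
move=> f0; apply/funext => -[|k]; rewrite /fps_mul /fps_of_poly coef1.
  by rewrite big_ord1 subnn /fps_inv /= mulVr.
rewrite big_ord_recr /= subnn {2}/fps_inv /= nth_rcons size_fps_inv_seq ltnn eqxx.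
rewrite mulNr mulNr mulrAC mulVr // mul1r; apply/eqP; rewrite subr_eq0; apply/eqP.
by apply: eq_bigr => i _; rewrite nth_fps_inv_seq 1?mulrC // -ltnS.
Qed.

End PowerSeries.

Definition hilbert_series (K : fieldType) (n : nat)
    (Y : {fset proj_space K n}) : nat -> int :=
  fun d => (hilbert_function Y d)%:Z.

(* Main.v *)
Require Import Defs.
From HB Require Import structures.
From mathcomp Require Import all_boot all_order all_algebra.
From mathcomp Require Import finmap.
From mathcomp Require Import boolp classical_sets.
From mathcomp Require Import mpoly.
From mathcomp Require Import zify.

(** Modulo the products [prod_(c in A_i) (t_i - c u)] every form of degree [e]
    reduces to a combination of the monomials [t^a u^(e - |a|)] with [a_i < d_i]
    and [|a| <= e]. Such a combination is determined by its values at the points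
    of the grid, since the relevant interpolation matrix is a tensor product of
    Vandermonde matrices. Hence these products generate the vanishing ideal, and
    the Hilbert function at [e] counts the exponents [a] of weight at most [e].

    For the height, a prime containing the products contains for each [i] some
    [t_i - a_i u], hence the prime of a point, which ends the chain of primes
    [(t_1 - a_1 u, ..., t_k - a_k u)], [k <= n]. A longer chain below a point
    would extend to a chain of length [n + 2] below the origin, exceeding the
    Krull dimension [n + 1] of the polynomial ring; that bound follows from the
    algebraic dependence of [m + 1] polynomials in [m] variables. *)

Set Implicit Arguments.
Unset Strict Implicit.
Unset Printing Implicit Defensive.

Import GRing.Theory.

Local Open Scope ring_scope.
Local Open Scope classical_set_scope.

Require Import Defs.
From HB Require Import structures.
From mathcomp Require Import all_boot all_order all_algebra.
From mathcomp Require Import finmap.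
From mathcomp Require Import boolp classical_sets.
From mathcomp Require Import mpoly.
From mathcomp Require Import zify.

Set Implicit Arguments.
Unset Strict Implicit.
Unset Printing Implicit Defensive.

Import GRing.Theory.

Local Open Scope ring_scope.
Local Open Scope classical_set_scope.

(** * Algebraic dependence and the bound on chains of primes *)

Lemma msize_prod_exp_le (R : idomainType) (m h e D : nat)
    (y : 'I_h -> {mpoly R[m]}) (a : 'I_h -> nat) :
    (forall i, (msize (y i) <= e.+1)%N) -> (forall i, (a i <= D)%N) ->
  (msize (\prod_i y i ^+ a i)%R <= (h * (D * e)).+1)%N.
Proof.
move=> ye aD.
have mulP (p q : {mpoly R[m]}) r s : (msize p <= r.+1)%N ->
    (msize q <= s.+1)%N -> (msize (p * q)%R <= (r + s).+1)%N.
  have [->|p0] := eqVneq p 0; first by rewrite mul0r msize0.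
  have [->|q0] := eqVneq q 0; first by rewrite mulr0 msize0.
  by rewrite msizeM //; lia.
have expP i : (msize (y i ^+ a i)%R <= (a i * e).+1)%N.
  elim: (a i) => [|b IHb]; first by rewrite expr0 msize1.
  by rewrite exprS mulSn; apply: mulP.
have -> : (h * (D * e) = \sum_(i < h) D * e)%N by rewrite sum_nat_const card_ord.
elim/big_rec2: _ => [|i s p _ IHs]; first by rewrite msize1.
apply: mulP => //; apply: leq_trans (expP i) _.
by rewrite ltnS leq_mul2r aD orbT.
Qed.

(* Products of powers below D of h > m polynomials of degree at most e number
   D ^ h, while they lie in a space of dimension (h * D * e + 1) ^ m; the former
   is larger once D > (h * e + 1) ^ m. *)
Lemma mpoly_dependent (K : fieldType) (m h : nat) (y : 'I_h -> {mpoly K[m]}) :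
    (m < h)%N ->
  exists D (c : {ffun 'I_h -> 'I_D} -> K),
    (exists a, c a != 0) /\ \sum_a c a *: \prod_i y i ^+ a i = 0.
Proof.
move=> mh.
pose e := (\max_i msize (y i))%N.
pose D := ((h * e).+1 ^ m).+1.
pose N := (h * (D * e))%N.
have ye i : (msize (y i) <= e.+1)%N.
  by apply: leqW; rewrite /e; exact: leq_bigmax.
pose mono (b : {ffun 'I_m -> 'I_N.+1}) := [multinom (b i : nat) | i < m].
pose prodE (a : {ffun 'I_h -> 'I_D}) := \prod_i y i ^+ a i.
(* Row [a] lists the coefficients of the product with exponents [a]. With more rows than columns,
   [M] has a non-zero left kernel, which supplies the relation. *)
pose M : 'M[K]_(#|{ffun 'I_h -> 'I_D}|, #|{ffun 'I_m -> 'I_N.+1}|) :=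
  \matrix_(i, j) (prodE (enum_val i))@_(mono (enum_val j)).
have cardlt : (#|{ffun 'I_m -> 'I_N.+1}| < #|{ffun 'I_h -> 'I_D}|)%N.
  rewrite !card_ffun !card_ord.
  apply: (@leq_ltn_trans ((D * (h * e).+1) ^ m)%N).
    have Nle : (N.+1 <= D * (h * e).+1)%N by rewrite /N; nia.
    by have [m0|m0] := posnP m; [rewrite m0 !expn0|rewrite leq_exp2r].
  rewrite expnMn; apply: (@leq_trans (D ^ m * D)%N).
    by rewrite ltn_pmul2l ?expn_gt0 // /D ltnS.
  by rewrite -expnSr; apply: leq_pexp2l.
have /matrix0Pn[i [j ij]] : kermx M != 0.
  rewrite kermx_eq0; apply/negP => /eqP r.
  by have := rank_leq_col M; rewrite r leqNgt cardlt.
exists D, (fun a => kermx M i (enum_rank a)); split.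
  by exists (enum_val j); rewrite enum_valK.
apply/mpolyP => k; rewrite mcoeff0 raddf_sum /=.
under eq_bigr do rewrite mcoeffZ.
(* No product reaches a degree above [N]; a monomial of degree at most [N] has all its exponents at
   most [N], so it indexes a column of [M]. *)
have [kN|kN] := leqP (mdeg k) N; last first.
  apply: big1 => a _; rewrite memN_msupp_eq0 ?mulr0 //.
  apply: msize_mdeg_ge; apply: leq_trans kN.
  by apply: msize_prod_exp_le => // l; exact: ltnW.
have kle l : (k l <= N)%N.
  by apply: leq_trans kN; rewrite mdegE (bigD1 l) //= leq_addr.
pose b : {ffun 'I_m -> 'I_N.+1} := [ffun l => inord (k l)].
have kb : mono b = k by apply/mnmP => l; rewrite mnmE ffunE inordK ?ltnS.
have /matrixP/(_ i (enum_rank b)) := mulmx_ker M.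
rewrite !mxE (reindex (enum_rank : _ -> 'I__)) /=; last first.
  by apply: onW_bij; exact: enum_rank_bij.
move=> E; rewrite -[RHS]E; apply: eq_bigr => a _.
by congr (_ * _); rewrite mxE !enum_rankK kb.
Qed.

(* A relation between elements y_k of C_{k+1} \ C_k reduces to a nonzero constant
   in the top prime: among the terms of the relation keep those of least exponent
   in y_0, cancel the power of y_0 modulo the prime C_0, and drop the remaining
   multiples of y_0 modulo C_1; then go on with y_1 modulo C_1, and so on. *)
Lemma prime_chain_le (K : fieldType) (m h : nat) (P : set {mpoly K[m]}) :
  has_prime_chain P h -> (h <= m)%N.
Proof.
case=> C [Cprime Clt _]; rewrite leqNgt; apply/negP => mh.
have Cid k : (k <= h)%N -> is_ideal (C k) by case/Cprime.
have /choice[y yP] : forall k : 'I_h,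
    exists y : {mpoly K[m]}, C k.+1 y /\ ~ C k y.
  move=> k; have [_ nsub] := Clt _ (ltn_ord k).
  apply: contrapT => /forallNP H; apply: nsub => x Cx.
  by apply: contrapT => nCx; apply: (H x).
have [D [c [[a0 ca0] rel]]] := mpoly_dependent y mh.
have CD k : (k <= h)%N -> forall (I : finType) (Q : pred I) F,
    (forall i, Q i -> C k (F i)) -> C k (\sum_(i | Q i) F i).
  move=> kh I Q F; have [C0 CD _] := Cid k kh.
  by move=> H; elim/big_ind: _.
have CN k x z : (k <= h)%N -> C k (x + z) -> C k z -> C k x.
  move=> kh; have [_ CDk CM] := Cid k kh => Cxz Cz.
  by rewrite -(addrK z x); apply: CDk => //; rewrite -mulN1r; apply: CM.
(* [T] holds the exponents of the terms that survive [i] rounds. They agree in their first [i]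
   coordinates, so a single one is left after [h] rounds. *)
have step (i : nat) : (i <= h)%N -> exists T : {set {ffun 'I_h -> 'I_D}},
    [/\ T != finset.set0, forall a, a \in T -> c a != 0,
        forall a b, a \in T -> b \in T -> forall j : 'I_h, (j < i)%N -> a j = b j &
        C i (\sum_(a in T) c a *: \prod_(j < h | (i <= j)%N) y j ^+ a j)].
  elim: i => [_|i IHi ih].
    exists [set a | c a != 0]%SET; split=> //.
    - by apply/set0Pn; exists a0; rewrite inE.
    - by move=> a; rewrite inE.
    - have [C0 _ _] := Cid 0%N (leq0n h).
      suff -> : \sum_(a in [set a | c a != 0]%SET)
          c a *: \prod_(j < h | (0 <= j)%N) y j ^+ a j = 0 by [].
      rewrite -[RHS]rel [RHS](bigID [pred a | c a != 0]) /= [X in _ + X]big1 ?addr0.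
        by apply: eq_bigl => a; rewrite inE.
      by move=> a /negbNE/eqP ->; rewrite scale0r.
  have {IHi}[T [T0 Tc Tagree CT]] := IHi (ltnW ih).
  pose k := Ordinal ih; have [Cy nCy] := yP k.
  have /set0Pn[b0 b0T] := T0.
  have [b bT bmin] : exists2 b, b \in T & forall a, a \in T -> (b k <= a k)%N.
    case: (arg_minnP (fun b : {ffun 'I_h -> 'I_D} => val (b k)) b0T) => b bT H.
    by exists b.
  exists [set a in T | a k == b k]%SET; split.
  - by apply/set0Pn; exists b; rewrite inE bT /=.
  - by move=> a; rewrite inE => /andP[/Tc].
  - move=> a a'; rewrite !inE => /andP[aT /eqP ab] /andP[a'T /eqP a'b] j.
    rewrite ltnS leq_eqVlt => /orP[/eqP ji|]; last exact: Tagree.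
    by rewrite (_ : j = k) ?ab ?a'b //; apply: val_inj.
  have prodk (a : {ffun 'I_h -> 'I_D}) : \prod_(j < h | (i <= j)%N) y j ^+ a j =
      y k ^+ a k * \prod_(j < h | (i < j)%N) y j ^+ a j.
    rewrite (bigD1 k) //=; congr (_ * _); apply: eq_bigl => j.
    by rewrite ltn_neqAle andbC eq_sym.
  pose G a := c a *: (y k ^+ (a k - b k) * \prod_(j < h | (i < j)%N) y j ^+ a j).
  have CG : C i (\sum_(a in T) G a).
    have [_ _ Cmul] := Cprime _ (ltnW ih).
    have nCX e : ~ C i (y k ^+ e).
      elim: e => [|e IHe]; first by rewrite expr0; case: (Cprime _ (ltnW ih)).
      by rewrite exprS => /Cmul[].
    have E : \sum_(a in T) c a *: \prod_(j < h | (i <= j)%N) y j ^+ a j =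
        y k ^+ b k * \sum_(a in T) G a.
      rewrite mulr_sumr; apply: eq_bigr => a aT.
      rewrite prodk /G -scalerAr mulrA -exprD subnKC //; exact: bmin.
    by move: CT; rewrite E => /Cmul[/nCX|].
  have {}CG : C i.+1 (\sum_(a in T) G a).
    by have [+ _] := Clt _ ih; apply.
  have [_ _ CM] := Cid _ ih.
  move: CG; rewrite (bigID [pred a : {ffun 'I_h -> 'I_D} | a k == b k]) /=.
  move=> /(CN _ _ _ ih) H.
  have {H} : C i.+1 (\sum_(a in T | a k == b k) G a).
    apply: H; apply: CD => // a /andP[aT akb].
    rewrite /G -mul_mpolyC; apply: (CM); rewrite mulrC; apply: (CM).
    rewrite (_ : _ - _ = (a k - b k).-1.+1)%N; first by rewrite exprSr; apply: CM.
    by rewrite prednK // subn_gt0 ltn_neqAle eq_sym akb bmin.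
  rewrite (eq_bigr (fun a => c a *: \prod_(j < h | (i < j)%N) y j ^+ a j)).
    by congr (C i.+1 _); apply: eq_bigl => a; rewrite inE.
  by move=> a /andP[_ /eqP akb]; rewrite /G akb subnn expr0 mul1r.
have [T [/set0Pn[a aT] Tc Tagree]] := step h (leqnn h).
have -> : T = [set a]%SET.
  apply/setP => b; rewrite inE; apply/idP/eqP => [bT|-> //].
  by apply/ffunP => j; apply: (Tagree _ _ bT aT).
rewrite big_set1 big1 => [|j]; last by rewrite leqNgt ltn_ord.
have [[_ _ CM] n1 _] := Cprime h (leqnn h).
move=> /(CM ((c a)^-1)%:MP); rewrite mul_mpolyC scalerA mulVf ?scale1r //.
exact: Tc.
Qed.

(** * Primes of points and the height of the grid ideal *)

Lemma kernel_prime (R : comNzRingType) (S : idomainType) (f : {rmorphism R -> S}) :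
  is_prime_ideal [set x | f x = 0].
Proof.
split=> [||x y /=].
- split=> [|x y /= x0 y0|c x /= x0]; first exact: rmorph0.
    by rewrite rmorphD x0 y0 addr0.
  by rewrite rmorphM x0 mulr0.
- by rewrite /= rmorph1 => /eqP; rewrite oner_eq0.
- by rewrite rmorphM => /eqP; rewrite mulf_eq0 => /orP[]/eqP; [left|right].
Qed.

(** Congruence modulo an ideal respects sums and products, hence substitution. This lets the kernel
    of a substitution be compared with ideals containing the differences of the variables and their
    images. *)
Lemma comp_mpoly_congr (R : comNzRingType) (m : nat) (I : set {mpoly R[m]})
    (q : m.-tuple {mpoly R[m]}) :
    is_ideal I -> (forall i, I ('X_i - tnth q i)) ->
  forall f, I (f - (f \mPo q)).
Proof.
move=> [I0 ID IM] Iq.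
have congM x x' z z' : I (x - x') -> I (z - z') -> I (x * z - x' * z').
  move=> Ix Iz; have -> : x * z - x' * z' = x * (z - z') + z' * (x - x').
    by rewrite !mulrBr (mulrC z' x) (mulrC z' x') addrA subrK.
  by apply: ID; apply: IM.
elim/mpolyind => [|c k p _ _ Ip]; first by rewrite comp_mpoly0 subrr.
rewrite comp_mpolyD comp_mpolyZ opprD addrACA -scalerBr -mul_mpolyC.
apply: ID => //; apply: IM; rewrite comp_mpolyX mpolyXE_id.
elim/big_rec2: _ => [|i x z _ Ixz]; first by rewrite subrr.
apply: (congM) => //; elim: (k i) => [|e IHe]; first by rewrite !expr0 subrr.
by rewrite !exprS; apply: congM.
Qed.

Section PointIdeals.
Variables (K : fieldType) (n : nat) (a : 'I_n -> K).
Local Notation S := {mpoly K[n.+1]}.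

Definition point_subst (k : nat) : n.+1.-tuple S :=
  [tuple if unlift ord_max j is Some i
         then if (i < k)%N then u_ K n * (a i)%:MP else t_ K i else u_ K n | j < n.+1].

(* The prime ideal (t_1 - a_1 u, ..., t_k - a_k u), as the kernel of a
   substitution. *)
Definition point_prime (k : nat) : set S := [set f | f \mPo point_subst k = 0].

Lemma point_prime_prime k : is_prime_ideal (point_prime k).
Proof. exact: (kernel_prime (comp_mpoly (point_subst k))). Qed.

Lemma comp_point_subst_u k : u_ K n \mPo point_subst k = u_ K n.
Proof. by rewrite comp_mpolyXU -tnth_nth tnth_mktuple unlift_none. Qed.

Lemma point_prime_lin k (i : 'I_n) :
  point_prime k (t_ K i - u_ K n * (a i)%:MP) <-> (i < k)%N.
Proof.
rewrite /point_prime /= comp_mpolyB rmorphM /= comp_point_subst_u comp_mpolyC.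
rewrite comp_mpolyXU -tnth_nth tnth_mktuple liftK.
case: ltnP => _; first by rewrite subrr.
(* For [i >= k] the substitution fixes the linear form, whose coefficient at [t_ K i] is 1. *)
split=> // /(congr1 (mcoeff U_(lift ord_max i))).
rewrite mulrC mul_mpolyC mcoeffB mcoeffZ !mcoeffXU eqxx.
rewrite (negbTE (neq_lift _ _)) mulr0 subr0 mcoeff0 => /eqP.
by rewrite oner_eq0.
Qed.

(** Modulo [I] every variable equals its image under the substitution, so [f] is congruent to its
    own image, which is 0. *)
Lemma point_prime_sub k (I : set S) :
    is_ideal I -> (forall i : 'I_n, (i < k)%N -> I (t_ K i - u_ K n * (a i)%:MP)) ->
  point_prime k `<=` I.
Proof.
move=> Iid Ilin f f0; rewrite -[f]subr0 -f0.
apply: comp_mpoly_congr => // j; rewrite tnth_mktuple.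
have [I0 _ _] := Iid.
case: unliftP => [i ->|->]; last by rewrite subrr.
by case: ltnP => [/Ilin //|_]; rewrite subrr.
Qed.

Lemma point_prime_proper k : (k < n)%N -> point_prime k `<` point_prime k.+1.
Proof.
move=> kn; split.
  apply: point_prime_sub => [|i ik]; first by case: (point_prime_prime k.+1).
  by apply/point_prime_lin; exact: leqW.
move/(_ (t_ K (Ordinal kn) - u_ K n * (a (Ordinal kn))%:MP)).
rewrite !point_prime_lin /= ltnn ltnS => /(_ (leqnn k)).
by [].
Qed.

(** Only the top of the standard chain is replaced by [P]. The last inclusion stays strict because
    [P] contains [point_prime n]. *)
Lemma point_prime_chain (P : set S) :
    is_prime_ideal P -> (forall i, P (t_ K i - u_ K n * (a i)%:MP)) ->
  has_prime_chain P n.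
Proof.
move=> Pp Plin; exists (fun k => if (k < n)%N then point_prime k else P).
have subP k : point_prime k `<=` P by case: Pp => Pid _ _; exact: point_prime_sub.
split=> [k _|k kn|]; last by rewrite ltnn.
  by case: ifP => // _; exact: point_prime_prime.
rewrite kn; have [+ lek] := point_prime_proper kn.
case: ifP => // _ subk; split; first exact: subP.
by move=> Psub; apply: lek => f /subP /Psub.
Qed.

Lemma point_prime_height : prime_height_is (point_prime n) n.
Proof.
split.
  by apply: point_prime_chain => [|i]; [exact: point_prime_prime|exact/point_prime_lin].
move=> k [C [Cp Clt Ck]]; rewrite -ltnS.
pose M := [set f : S | f.@[fun=> 0] = 0].
have Mp : is_prime_ideal M by exact: (kernel_prime (meval (fun=> 0))).
apply: (@prime_chain_le K n.+1 k.+1 M).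
exists (fun j => if (j <= k)%N then C j else M).
split=> [j _|j|]; last by rewrite ltnn.
  by case: ifP => [/Cp|].
rewrite ltnS => jk; rewrite jk; case: ltnP => [/Clt //|kj].
have -> : j = k by apply/eqP; rewrite eqn_leq jk.
rewrite Ck; split.
  apply: point_prime_sub => [|i _]; first by case: Mp.
  by rewrite /M /= mevalB mevalM !mevalXU mul0r subrr.
(* The added inclusion is strict: [u_ K n] vanishes at the origin, but the substitution fixes it, so
   it is not in the prime of the point. *)
move=> /(_ (u_ K n)); rewrite /M /point_prime /= mevalXU comp_point_subst_u.
move/(_ erefl) => /(congr1 (mcoeff U_(ord_max))); rewrite mcoeffXU eqxx mcoeff0.
by move/eqP; rewrite oner_eq0.
Qed.

End PointIdeals.

Lemma prime_prod (R : comNzRingType) (P : set R) (T : Type) (s : seq T)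
    (F : T -> R) :
  is_prime_ideal P -> P (\prod_(x <- s) F x) -> exists x, P (F x).
Proof.
move=> [_ nP1 PM]; elim: s => [|x s IHs]; first by rewrite big_nil.
by rewrite big_cons => /PM[|/IHs //]; exists x.
Qed.

Lemma ideal_gen_sub (R : comNzRingType) (G J : set R) :
  is_ideal J -> G `<=` J -> ideal_gen G `<=` J.
Proof. by move=> Jid GJ f; apply; split. Qed.

Lemma sub_ideal_gen (R : comNzRingType) (G : set R) : G `<=` ideal_gen G.
Proof. by move=> f Gf J [_]; apply. Qed.

Lemma grid_ideal_height (K : fieldType) (n : nat) (A : 'I_n -> {fset K})
    (A_neq0 : forall i, A i != fset0) :
  height_is (ideal_gen (range (fun i : 'I_n =>
    \prod_(c <- A i) (t_ K i - u_ K n * c%:MP)))) n.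
Proof.
split.
  have /choice[a aA] : forall i, exists c, c \in A i by move=> i; exact/fset0Pn.
  exists (point_prime a n).
  split; [exact: point_prime_prime| |exact: point_prime_height].
  apply: ideal_gen_sub; first by case: (point_prime_prime a n).
  move=> _ [i _ <-]; rewrite (big_rem _ (aA i)) /= mulrC.
  have [[_ _ +] _ _] := point_prime_prime a n; apply.
  exact/point_prime_lin.
(* The height of [P] bounds the length of every chain ending in [P], so one chain of length [n]
   suffices. *)
move=> P k Pp subP [_ maxP]; apply: maxP.
have /choice[a Pa] : forall i, exists c, P (t_ K i - u_ K n * c%:MP).
  move=> i; apply: (prime_prod (s := A i) (F := fun c => t_ K i - u_ K n * c%:MP) Pp).
  by apply: (subP); apply: sub_ideal_gen; exists i.
exact: point_prime_chain Pp Pa.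
Qed.

(** * Exponents in the box and interpolation on the grid *)

Section Grid.
Variables (K : fieldType) (n : nat) (A : 'I_n -> {fset K}).
Local Notation d i := #|` A i|.
Local Notation B := (\max_(i < n) d i).+1.
Local Notation exps := {ffun 'I_n -> 'I_B}.
Implicit Types (e : nat) (a b : exps).

(** The common bound [B] puts exponents with different ranges into one finite type; its successor
    form is what [inord] requires. *)
Definition in_box a := [forall i, (a i < d i)%N].
Definition weight a : nat := \sum_i a i.
Definition low_box e a := in_box a && (weight a <= e)%N.

(** Distributivity, stated over any semiring so as to serve interpolation over [K], counting in
    [nat] and the generating polynomial over [int]. *)
Lemma prod_sum_box (R : comNzSemiRingType) (F : 'I_n -> nat -> R) :
  \prod_i \sum_(j < d i) F i j = \sum_(a | in_box a) \prod_i F i (a i).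
Proof.
have dB i : (d i <= B)%N by apply: leqW; exact: leq_bigmax.
under eq_bigr => i _ do rewrite (big_ord_widen B (F i)) //.
by rewrite bigA_distr_big_dep; apply: eq_bigl => a.
Qed.

End Grid.

(* The weights are the entries of the inverse of a Vandermonde matrix. *)
Lemma dual_weights (K : fieldType) (s : seq K) : uniq s ->
  exists w : nat -> nat -> K, forall k l, (k < size s)%N -> (l < size s)%N ->
    \sum_(j < size s) w k j * s`_j ^+ l = (k == l)%:R.
Proof.
case sz: (size s) => [|m] us; first by exists (fun _ _ => 0).
pose V : 'M[K]_m.+1 := Vandermonde m.+1 (\row_j s`_j).
have uV : V \in unitmx.
  rewrite unitmxE det_Vandermonde unitfE; apply/prodf_neq0 => i _.
  apply/prodf_neq0 => j ij; rewrite !mxE subr_eq0.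
  by rewrite nth_uniq ?sz // gtn_eqF.
exists (fun k j => invmx V (inord j) (inord k)) => k l km lm.
have /matrixP/(_ (inord l) (inord k)) := mulmxV uV.
rewrite !mxE -val_eqE /= !inordK // eq_sym => <-; apply: eq_bigr => j _.
by rewrite !mxE inord_val inordK // mulrC.
Qed.

Section Interpolation.
Variables (K : fieldType) (n : nat) (A : 'I_n -> {fset K}).
Local Notation d i := #|` A i|.
Local Notation B := (\max_(i < n) d i).+1.
Local Notation exps := {ffun 'I_n -> 'I_B}.

Lemma grid_interpolation (Q : pred exps) (c : exps -> K) :
    (forall a, Q a -> in_box a) ->
    (forall g : 'I_n -> K, (forall i, g i \in A i) ->
       \sum_(a | Q a) c a * \prod_i g i ^+ a i = 0) ->
  forall b, Q b -> c b = 0.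
Proof.
move=> Qbox c0 b Qb.
have /choice[w wP] i := dual_weights (fset_uniq (A i)).
pose g (a : exps) i : K := (A i)`_(a i).
(* Products of one-variable dual weights extract [c b] from the grid values: the sum over the grid
   factors into one-variable sums, one of which vanishes as soon as [a] differs from [b]. *)
have -> : c b = \sum_(a' | in_box a')
    (\prod_i w i (b i) (a' i)) * \sum_(a | Q a) c a * \prod_i g a' i ^+ a i.
  under eq_bigr do rewrite mulr_sumr.
  rewrite exchange_big /= (bigD1 b) //= [X in _ + X]big1 ?addr0; last first.
    move=> a /andP[/Qbox/forallP abox ab].
    under eq_bigr do rewrite mulrCA -big_split /=.
    rewrite -mulr_sumr -(prod_sum_box A (fun i j => w i (b i) j * (A i)`_j ^+ a i)).
    have [i abi] : exists i, b i != a i.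
      apply/existsP; rewrite -negb_forall; apply: contra ab => /eqfunP ba.
      by apply/eqP/ffunP => i; rewrite ba.
    rewrite (bigD1 i) //= wP ?abox //; last by move/Qbox/forallP: Qb.
    by rewrite val_eqE (negbTE abi) mul0r mulr0.
  under eq_bigr do rewrite mulrCA -big_split /=.
  rewrite -mulr_sumr -(prod_sum_box A (fun i j => w i (b i) j * (A i)`_j ^+ b i)).
  have /forallP bbox := Qbox _ Qb.
  by rewrite big1 ?mulr1 // => i _; rewrite wP ?bbox // eqxx.
apply: big1 => a' /forallP a'box; rewrite c0 ?mulr0 // => i.
exact: mem_nth.
Qed.

End Interpolation.

(** * Reduction of forms to box monomials *)

Lemma prod_XsubC_homogenize (R : comNzRingType) (T : comAlgType R) (s : seq R)
    (x u : T) :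
  \prod_(c <- s) (x - u * c%:A) =
  \sum_(j < (size s).+1)
    (\prod_(c <- s) ('X - c%:P))`_j *: (x ^+ j * u ^+ (size s - j)).
Proof.
elim: s => [|c s IHs].
  by rewrite !big_nil big_ord1 coef1 scale1r expr0 mul1r.
rewrite !big_cons IHs; set p := \prod_(c0 <- s) _.
(* Both sums on the right have one extra end term, and both are zero: the constant coefficient of
   ['X * p], and the coefficient of [p] just past its degree. *)
have p0 : p`_(size s).+1 = 0 by rewrite nth_default // size_prod_XsubC.
under [RHS]eq_bigr do rewrite mulrBl coefB scalerBl.
rewrite sumrB mulrBl; congr (_ - _).
  rewrite [RHS]big_ord_recl /= coefXM scale0r add0r mulr_sumr; apply: eq_bigr => j _.
  by rewrite coefXM /= -scalerAr mulrA -exprS.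
rewrite [RHS]big_ord_recr /= coefCM p0 mulr0 scale0r addr0 mulr_sumr.
apply: eq_bigr => j _; rewrite coefCM -mulrA -scalerAl mul1r -!scalerAr scalerA.
by rewrite [u * _]mulrCA -exprS subSn // -ltnS.
Qed.

Section BoxMonomials.
Variables (K : fieldType) (n : nat) (A : 'I_n -> {fset K}).
Local Notation S := {mpoly K[n.+1]}.
Local Notation d i := #|` A i|.
Local Notation B := (\max_(i < n) d i).+1.
Local Notation exps := {ffun 'I_n -> 'I_B}.
Implicit Types (e : nat) (a b : exps).

(* The exponent of t^a u^(e - |a|). *)
Definition box_mon e a : 'X_{1..n.+1} :=
  [multinom (if unlift ord_max j is Some i then a i : nat else (e - weight a)%N)
  | j < n.+1].

Lemma mdeg_box_mon e a : (weight a <= e)%N -> mdeg (box_mon e a) = e.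
Proof.
move=> ae; rewrite mdegE (bigD1_ord ord_max) //= mnmE unlift_none.
under eq_bigr do rewrite mnmE liftK.
by rewrite subnK.
Qed.

Lemma meval_box_mon e a (g : 'I_n -> K) :
  ('X_[box_mon e a] : S).@[fun j => affine_vec g 0 j] = \prod_i g i ^+ a i.
Proof.
rewrite mevalX (bigD1_ord ord_max) //= mnmE mxE unlift_none expr1n mul1r.
by apply: eq_bigr => i _; rewrite mnmE mxE liftK.
Qed.

Variable J : set S.
Hypothesis Jid : is_ideal J.
Hypothesis JA : forall i, J (\prod_(c <- A i) (t_ K i - u_ K n * c%:MP)).

(** The ideal [J] is kept abstract since the reduction is applied both to the ideal generated by the
    products and to the vanishing ideal. *)
Definition reducible e (f : S) := exists c : exps -> K,
  J (f - \sum_(a | low_box e a) c a *: 'X_[box_mon e a]).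

Lemma reducible0 e : reducible e 0.
Proof.
exists (fun=> 0); rewrite big1 ?subrr; first by case: Jid.
by move=> a _; rewrite scale0r.
Qed.

Lemma reducibleD e f g : reducible e f -> reducible e g -> reducible e (f + g).
Proof.
move=> [c Jc] [c' Jc']; exists (fun a => c a + c' a).
under eq_bigr do rewrite scalerDl.
by rewrite big_split /= opprD addrACA; case: Jid => _ + _; apply.
Qed.

Lemma reducibleZ e k f : reducible e f -> reducible e (k *: f).
Proof.
move=> [c Jc]; exists (fun a => k * c a).
under eq_bigr do rewrite -scalerA.
by rewrite -scaler_sumr -scalerBr -mul_mpolyC; case: Jid => _ _; apply.
Qed.

Lemma reducible_sum e (I : Type) (r : seq I) (P : pred I) (F : I -> S) :
  (forall i, P i -> reducible e (F i)) -> reducible e (\sum_(i <- r | P i) F i).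
Proof. by move=> H; elim/big_ind: _ => //; [exact: reducible0|exact: reducibleD]. Qed.

Lemma reducible_mod e f g : J (f - g) -> reducible e g -> reducible e f.
Proof.
move=> Jfg [c Jc]; exists c; rewrite -(subrK g f) -addrA.
by case: Jid => _ + _; apply.
Qed.

Lemma reducible_box e a : low_box e a -> reducible e 'X_[box_mon e a].
Proof.
move=> ae; exists (fun b => (b == a)%:R); rewrite (bigD1 a) //= eqxx scale1r.
rewrite big1 ?addr0 ?subrr; first by case: Jid.
by move=> b /andP[_ /negbTE ->]; rewrite scale0r.
Qed.

(* Induction on the degree in the t_i: if t_i occurs with exponent at least d_i,
   rewrite t_i ^ d_i modulo the i-th generator. *)
Lemma reducible_monomial (k : 'X_{1..n.+1}) : reducible (mdeg k) 'X_[k].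
Proof.
have mdegk (m : 'X_{1..n.+1}) :
    mdeg m = (m ord_max + \sum_(i < n) m (lift ord_max i))%N.
  by rewrite mdegE (bigD1_ord ord_max).
have [N] := ubnP (\sum_(i < n) k (lift ord_max i)); elim: N k => // N IHN k kN.
have [small|/forallPn[i]] := boolP [forall i : 'I_n, (k (lift ord_max i) < d i)%N].
  pose a : exps := [ffun i => inord (k (lift ord_max i))].
  have aE i : a i = k (lift ord_max i) :> nat.
    rewrite ffunE inordK // ltnS ltnW //; apply: leq_trans (forallP small i) _.
    exact: leq_bigmax.
  have wa : weight a = (\sum_(i < n) k (lift ord_max i))%N.
    by apply: eq_bigr => i _; rewrite aE.
  have -> : k = box_mon (mdeg k) a.
    apply/mnmP => j; rewrite mnmE; case: unliftP => [i ->|->]; first by rewrite aE.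
    by rewrite wa mdegk addnK.
  rewrite mdeg_box_mon; last by rewrite wa mdegk leq_addl.
  apply: reducible_box; rewrite /low_box wa mdegk leq_addl andbT.
  by apply/forallP => i; rewrite aE; exact: (forallP small).
rewrite -leqNgt => dik.
pose ti : 'I_n.+1 := lift ord_max i.
pose k0 : 'X_{1..n.+1} := (k - U_(ti) *+ d i)%MM.
have kE : k = (k0 + U_(ti) *+ d i)%MM.
  rewrite submK //; apply/mnm_lepP => j; rewrite mulmnE mnm1E.
  by case: eqP => [<-|]; rewrite ?mul1n.
pose p := \prod_(c <- A i) ('X - c%:P).
pose k' (j : nat) : 'X_{1..n.+1} :=
  (k0 + (U_(ti) *+ j + U_(ord_max) *+ (d i - j)))%MM.
(* The generator is the homogenization of the monic [p]; multiplied by ['X_[k0]], it trades ['X_[k]]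
   for the monomials ['X_[k' j]]. *)
apply: (@reducible_mod _ _ (- \sum_(j < d i) p`_j *: 'X_[k' j])).
  have [_ _ JM] := Jid; move: (JM 'X_[k0] _ (JA i)).
  rewrite (eq_bigr (fun c : K => t_ K i - u_ K n * c%:A)); last first.
    by move=> c _; rewrite -mul_mpolyC mulr1.
  rewrite prod_XsubC_homogenize big_ord_recr /= subnn expr0 mulr1 -/p.
  have -> : p`_(d i) = 1.
    have /monicP := monic_prod_XsubC (A i) xpredT id.
    by rewrite lead_coefE size_prod_XsubC.
  rewrite scale1r opprK mulrDr addrC mulr_sumr {1}kE mpolyXD mpolyXn.
  congr (J (_ + _)); apply: eq_bigr => j _.
  by rewrite -scalerAr /k' !mpolyXD -!mpolyXn.
rewrite -scaleN1r; apply/reducibleZ/reducible_sum => j _; apply: reducibleZ.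
have deg_k' : mdeg (k' j) = mdeg k.
  rewrite kE !mdegD !mdegMn !mdeg1 !mul1n subnKC //; exact: ltnW.
rewrite -deg_k'; apply: IHN; rewrite -ltnS; apply: leq_trans kN.
(* The total degree is unchanged while the exponent of [u] grows by [d i - j > 0], so the degree in
   the [t_i] drops. *)
have kmax : k' j ord_max = (k ord_max + (d i - j))%N.
  rewrite !mnmDE mnmBE !mulmnE !mnm1E eqxx.
  by rewrite eq_sym (negbTE (neq_lift _ _)) !mul0n subn0 mul1n.
by have := mdegk (k' j); rewrite deg_k' mdegk kmax; have := ltn_ord j; lia.
Qed.

Lemma reducible_homog e f : f \is e.-homog -> reducible e f.
Proof.
move=> fe; rewrite [f]mpolyE big_seq; apply: reducible_sum => m mf.
by apply: reducibleZ; rewrite -(dhomog_mf fe mf); exact: reducible_monomial.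
Qed.

End BoxMonomials.

(** * The vanishing ideal, its Hilbert function and the number of points *)

Lemma vanishing_ideal_eval (K : fieldType) (n : nat) (A : 'I_n -> {fset K})
    (f : {mpoly K[n.+1]}) (g : 'I_n -> K) :
    (forall i, g i \in A i) -> vanishing_ideal (projective_grid A) f ->
  f.@[fun j => affine_vec g 0 j] = 0.
Proof.
move=> gA; move: f; apply: ideal_gen_sub.
  by case: (kernel_prime (meval (fun j => affine_vec g 0 j))).
move=> f [_ fY]; apply: (fY (affine_point g)); last exact: affine_vec_neq0.
  by apply/projective_gridP; exists g.
exact: memv_line.
Qed.

Section HilbertFunction.
Variables (K : fieldType) (n : nat) (A : 'I_n -> {fset K}).
Local Notation S := {mpoly K[n.+1]}.
Local Notation d i := #|` A i|.
Local Notation B := (\max_(i < n) d i).+1.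
Local Notation exps := {ffun 'I_n -> 'I_B}.
Local Notation Y := (projective_grid A).
Local Notation gen i := (\prod_(c <- A i) (t_ K i - u_ K n * c%:MP)).

Lemma gen_homog i : gen i \is (d i).-homog.
Proof.
have lin c : t_ K i - u_ K n * c%:MP \is [in K[n.+1], 1.-homog].
  by rewrite mulrC mul_mpolyC rpredB ?rpredZ // dhomogX /= mdeg1.
elim: (enum_fset (A i)) => [|c s IHs]; first by rewrite big_nil dhomog1.
by rewrite big_cons; apply: (@dhomogM _ _ _ 1%N).
Qed.

Lemma vanishing_ideal_gen i : vanishing_ideal Y (gen i).
Proof.
apply: sub_ideal_gen; split; first by exists (d i); exact: gen_homog.
move=> P /projective_gridP[g gA ->] v /= /vlineP[k ->] _.
rewrite rmorph_prod (big_rem _ (gA i)) /= mevalB mevalM !mevalXU mevalC !mxE.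
by rewrite liftK unlift_none mulr1 subrr mul0r.
Qed.

(** At points with last coordinate 1 the power of [u] disappears, which leaves the affine
    interpolation problem. *)
Lemma box_combination_eq0 e (c : exps -> K) :
    (forall g : 'I_n -> K, (forall i, g i \in A i) ->
      (\sum_(a | low_box e a) c a *: 'X_[box_mon e a] : S).@[
         fun j => affine_vec g 0 j] = 0) ->
  forall a, low_box e a -> c a = 0.
Proof.
move=> H; apply: grid_interpolation => [a /andP[] //|g /H Hg].
rewrite -[RHS]Hg raddf_sum; apply: eq_bigr => a _.
by rewrite /= mevalZ meval_box_mon.
Qed.

Lemma vanishing_idealE :
  vanishing_ideal Y = ideal_gen (range (fun i : 'I_n => gen i)).
Proof.
apply/seteqP; split; apply: ideal_gen_sub.
- exact: ideal_gen_ideal.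
- move=> f [[e fe] fY].
  have Jgen i : ideal_gen (range (fun i : 'I_n => gen i)) (gen i).
    by apply: sub_ideal_gen; exists i.
  have [c Jc] := reducible_homog (ideal_gen_ideal _) Jgen fe.
  suff c0 a : low_box e a -> c a = 0.
    by move: Jc; rewrite big1 ?subr0 // => a /c0 ->; rewrite scale0r.
  apply: box_combination_eq0 => g gA.
  (* Both [f] and its difference from the normal form vanish on the grid, hence so does the normal
     form. *)
  have ev0 h : ideal_gen (range (fun i : 'I_n => gen i)) h ->
      h.@[fun j => affine_vec g 0 j] = 0.
    move=> Jh; apply: (vanishing_ideal_eval gA); move: h Jh.
    apply: ideal_gen_sub; first exact: ideal_gen_ideal.
    by move=> _ [i _ <-]; exact: vanishing_ideal_gen.
  have /eqP := ev0 _ Jc; rewrite mevalB subr_eq0 => /eqP <-.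
  apply: (fY (affine_point g)); [|exact: memv_line|exact: affine_vec_neq0].
  by apply/projective_gridP; exists g.
- exact: ideal_gen_ideal.
- by move=> _ [i _ <-]; exact: vanishing_ideal_gen.
Qed.

(** The box monomials of degree [e] are a basis modulo the vanishing ideal: reduction gives
    spanning, interpolation gives independence. *)
Lemma hilbert_function_grid e :
  hilbert_function Y e = #|[pred a : exps | low_box e a]|.
Proof.
apply/hilbert_functionP; set P := [pred a : exps | low_box e a].
have monh (i : 'I_#|P|) : 'X_[box_mon e (enum_val i)] \is [in K[n.+1], e.-homog].
  by rewrite dhomogX /= mdeg_box_mon //; case/andP: (enum_valP i).
pose b := [tuple DHomog (monh i) | i < #|P|]; exists b => v.
have sumE (c : 'rV[K]_#|P|) : mpoly_of_dhomog (v - \sum_i c 0 i *: tnth b i) =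
    mpoly_of_dhomog v - \sum_i c 0 i *: 'X_[box_mon e (enum_val i)].
  rewrite raddfB raddf_sum; congr (_ - _); apply: eq_bigr => i _.
  by rewrite tnth_mktuple.
have Iid : is_ideal (vanishing_ideal Y) := ideal_gen_ideal _.
have [c Ic] := reducible_homog Iid vanishing_ideal_gen (dhomog_is_dhomog v).
exists (\row_i c (enum_val i)); split.
  rewrite /mkset sumE; move: Ic; congr (vanishing_ideal Y (_ - _)).
  rewrite (big_enum_val (A := P) (fun a => c a *: 'X_[box_mon e a])).
  by apply: eq_bigr => i _; rewrite mxE.
move=> c'; rewrite /mkset sumE => Ic'; apply/rowP => i; rewrite mxE.
(* The row [c'] is reindexed by exponents; as [enum_val] is injective, each sum has at most one
   term. *)
pose c'' (a : exps) := \sum_(j | enum_val j == a) c' 0 j.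
have c''E j : c'' (enum_val j) = c' 0 j.
  by rewrite /c'' (big_pred1 j) // => k; rewrite (inj_eq enum_val_inj).
rewrite -c''E; apply/eqP; rewrite -subr_eq0; apply/eqP.
apply: (@box_combination_eq0 e (fun a => c a - c'' a)); last exact: (enum_valP i).
move=> g gA; apply: (vanishing_ideal_eval gA).
under eq_bigr do rewrite scalerBl.
rewrite sumrB (big_enum_val (A := P) (fun a => c'' a *: 'X_[box_mon e a])) /=.
have [_ ID IM] := Iid.
under [X in _ - X]eq_bigr do rewrite c''E.
have := ID _ _ Ic' (IM (-1) _ Ic).
by rewrite mulN1r opprB addrC addrA subrK.
Qed.

(** Two spanning vectors of one line differ by a scalar, which the last coordinate forces to be
    1. *)
Lemma affine_point_inj : injective (@affine_point K n).
Proof.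
move=> g g' /(congr1 val) /= gg'.
have : affine_vec g' \in <[affine_vec g]>%VS by rewrite gg' memv_line.
move=> /vlineP[k kE].
have k1 : k = 1.
  by move/rowP/(_ ord_max): kE; rewrite !mxE unlift_none mulr1 => <-.
apply/funext => i; move/rowP/(_ (lift ord_max i)): kE.
by rewrite !mxE liftK k1 mul1r.
Qed.

Lemma card_box : #|[pred a : exps | in_box a]| = (\prod_i d i)%N.
Proof.
have := prod_sum_box A (R := nat) (fun _ _ => 1).
under eq_bigr do rewrite sumr_const card_ord natn.
rewrite [RHS](eq_bigr (fun=> 1)); last by move=> a _; exact: big1_eq.
by rewrite sumr_const natn => ->.
Qed.

Lemma card_projective_grid : #|` Y| = (\prod_i d i)%N.
Proof.
pose f (a : {dffun forall i : 'I_n, A i}) := affine_point (fun i => val (a i)).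
have f_inj : injective f.
  move=> a a' /affine_point_inj aa'; apply/ffunP => i.
  by apply: val_inj; exact: (congr1 (fun h => h i) aa').
have -> : #|` Y| = size [seq f a | a : {dffun forall i : 'I_n, A i}].
  apply/perm_size/uniq_perm; first exact: fset_uniq.
    by rewrite map_inj_uniq // enum_uniq.
  by move=> P; rewrite inE.
rewrite size_map -cardE card_dep_ffun.
rewrite foldrE big_map big_enum /=.
by apply: eq_bigr => i _; rewrite cardfE.
Qed.

End HilbertFunction.

(** * Hilbert series and regularity *)

Section HilbertSeries.
Variables (K : fieldType) (n : nat) (A : 'I_n -> {fset K}).
Local Notation d i := #|` A i|.
Local Notation B := (\max_(i < n) d i).+1.
Local Notation exps := {ffun 'I_n -> 'I_B}.

Lemma coef_box_poly k :
  (\prod_(i < n) \sum_(j < d i) 'X^j : {poly int})`_k =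
  \sum_(a : exps | in_box a) (k == weight a)%:R.
Proof.
rewrite (prod_sum_box A (fun _ j => 'X^j)) coef_sum; apply: eq_bigr => a _.
by rewrite prodrXr coefXn.
Qed.

Lemma fps_inv_1subX (R : comUnitRingType) k :
  fps_inv (fps_of_poly (1 - 'X : {poly R})) k = 1.
Proof.
have coefE0 : fps_of_poly (1 - 'X : {poly R}) 0%N = 1.
  by rewrite /fps_of_poly coefB coef1 coefX subr0.
elim: k => [|k IHk]; first by rewrite /fps_inv /= coefE0 invr1.
have := fps_mulVf (f := fps_of_poly (1 - 'X : {poly R})).
rewrite coefE0 unitr1 => /(_ isT)/(congr1 (fun f => f k.+1)).
(* Only the last two terms of the convolution with [1 - 'X] survive, so consecutive coefficients of
   the inverse agree. *)
rewrite /fps_mul {3}/fps_of_poly coef1 /= big_ord_recr big_ord_recr /= big1 ?add0r.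
  rewrite subnn subSnn IHk coefE0 mulr1 mul1r {1}/fps_of_poly coefB coef1 coefX /=.
  by rewrite sub0r addrC => /eqP; rewrite subr_eq0 => /eqP.
move=> i _; rewrite /fps_of_poly coefB coef1 coefX.
have -> : (k.+1 - i = (k - i.+1).+2)%N by have := ltn_ord i; lia.
by rewrite subr0 mulr0.
Qed.

(** Dividing by [1 - 'X] forms partial sums, which turns the count of exponents of weight exactly
    [k] into that of weight at most [e]. *)
Lemma hilbert_series_grid :
  hilbert_series (projective_grid A) =
    fps_div (fps_of_poly (\prod_(i < n) \sum_(j < d i) 'X^j))
            (fps_of_poly (1 - 'X)).
Proof.
apply/funext => e; rewrite /hilbert_series hilbert_function_grid /fps_div /fps_mul.
under [RHS]eq_bigr do rewrite fps_inv_1subX mulr1 /fps_of_poly coef_box_poly.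
rewrite exchange_big /= -sum1_card -[LHS]natz natr_sum /= big_mkcondr /=.
apply: eq_bigr => a _; case: leqP => ae.
  rewrite (bigD1 (Ordinal (ae : weight a < e.+1)%N)) //= eqxx big1 ?addr0 //.
  by move=> i; rewrite -val_eqE /= => /negbTE ->.
rewrite big1 // => i _; case: eqP => // ia.
by have := ltn_ord i; rewrite ia ltnS leqNgt ae.
Qed.

Hypothesis A_neq0 : forall i, A i != fset0.

Lemma regularity_grid : regularity_is (projective_grid A) (\sum_(i < n) (d i - 1))%N.
Proof.
rewrite /regularity_is card_projective_grid -card_box; split=> [e le|l' H].
  rewrite hilbert_function_grid; apply: eq_card => a; rewrite !inE /low_box.
  apply: andb_idr => /forallP abox; apply: leq_trans le.
  by apply: leq_sum => i _; have := abox i; lia.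
have dpos i : (0 < d i)%N by rewrite cardfs_gt0.
(* The corner of the box has the largest weight; it lies in the box because every [A i] is
   non-empty. *)
pose a : exps := [ffun i => inord (d i - 1)].
have aE i : a i = (d i - 1)%N :> nat.
  rewrite ffunE inordK // ltnS; apply: leq_trans (leq_subr _ _) _.
  exact: leq_bigmax.
have abox : in_box a by apply/forallP => i; rewrite aE; have := dpos i; lia.
have := H l' (leqnn l'); rewrite hilbert_function_grid => E.
have sub : [pred b : exps | low_box l' b] \subset [pred b : exps | in_box b].
  by apply/fintype.subsetP => b; rewrite !inE => /andP[].
(* Equal cardinalities make the inclusion an equality, so the corner has weight at most [l']. *)
have := subset_cardP E sub a; rewrite !inE /low_box abox /= /weight.
by under eq_bigr do rewrite aE.
Qed.

End HilbertSeries.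

Theorem proposition2p5 (K : fieldType) (n : nat) (n_gt0 : (0 < n)%N)
    (A : 'I_n -> {fset K}) (A_neq0 : forall i, A i != fset0) :
  let d (i : 'I_n) : nat := #|` A i| in
  let Y := projective_grid A in
  [/\ vanishing_ideal Y =
        ideal_gen (range (fun i : 'I_n =>
          \prod_(c <- A i) (t_ K i - u_ K n * c%:MP))),
      complete_intersection (vanishing_ideal Y),
      hilbert_series Y =
        fps_div (fps_of_poly (\prod_(i < n) \sum_(j < d i) 'X^j))
                (fps_of_poly (1 - 'X)) &
      [/\ regularity_is Y (\sum_(i < n) (d i - 1))%N,
          degree_is Y #|` Y| &
          #|` Y| = (\prod_(i < n) d i)%N]].
Proof.
move=> d Y; have IY := vanishing_idealE A; split => //.
- exists n, (fun i => \prod_(c <- A i) (t_ K i - u_ K n * c%:MP)); split=> //.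
    by move=> i; exists (d i); exact: gen_homog.
  by rewrite IY; exact: grid_ideal_height.
- exact: hilbert_series_grid.
- have reg := regularity_grid A_neq0; split=> //; last exact: card_projective_grid.
  by exists (\sum_(i < n) (d i - 1))%N; case: reg.
Qed.
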